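(* Let $K$ be a field, let $I\subset S=K[X_1,\dots,X_n]$ be a monomial ideal, and let $i>0$. Suppose that $H^i_{\mathfrak m}(S/I)$ has finite length. Then for every $(i-1)$-dimensional face $\sigma\in\Delta$ and every $a\in\mathbb Z^n$ such that (a) $0\le a\le\rho-1$, (b) $L(a(\sigma),u)\neq\emptyset$ for all $u\in G_0(I)$, and (c) $a(\sigma)$ is maximal with the properties (a) and (b) for the fixed $\sigma$, there exists $\ell\in[m]\setminus\sigma$ such that (i) $a_\ell=\rho_\ell-1$, and (ii) for all $u\in G_0(I)$ with $\nu_\ell(u)=\rho_\ell$ we have $L(a(\sigma\cup\{\ell\}),u)\ne\emptyset$.
   Context: Notation: $\mathfrak m$ is the graded maximal ideal of $S/I$. $G(I)$ is the minimal set of monomial generators of $I$; for a monomial $u=X_1^{b_1}\cdots X_n^{b_n}$, $\nu_j(u)=b_j$ and $\operatorname{supp}(u)=\{j\mid b_j\ne0\}$. $\rho_j=\max\{\nu_j(u)\mid u\in G(I)\}$, and $\rho-1=(\rho_1-1,\dots,\rho_n-1)$. If $G(I)$ contains a pure power of $X_i$, that power is $X_i^{\rho_i}$. The variables are numbered so that $$G(I)=\{X_{m+1}^{\rho_{m+1}},\dots,X_n^{\rho_n}\}\cup G_0(I),\qquad m\le n,\qquad G_0(I)=\{u\in G(I)\mid|\operatorname{supp}(u)|\ge2\}.$$ $[k]=\{1,\dots,k\}$. $\Delta$ is the simplicial complex corresponding to the square-free monomial ideal $\sqrt I$: its faces are the sets $F\subset[n]$ such that $\operatorname{supp}(u)\not\subset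 F$ for every $u\in G(I)$; it is a complex over the vertex set $[m]$. A face $F$ has dimension $|F|-1$. $\mathbb Z^n$ is partially ordered componentwise. For $a\in\mathbb Z^n$ and a monomial $u\in S$, $L(a,u)=\{i\in[n]\mid\nu_i(u)>a_i\}$. For $a\in\mathbb Z^n$ with $a\le\rho-1$ and $\sigma\subset[n]$, $a(\sigma)\in\mathbb Z^n$ is defined by $a(\sigma)_i=a_i$ if $i\notin\sigma$ and $a(\sigma)_i=\rho_i$ if $i\in\sigma$. Maximality in (c) means: maximal in the componentwise order among all vectors $a'(\sigma)$ where $a'$ satisfies (a) and (b). *)

(* Defs.v *)
From HB Require Import structures.
From mathcomp Require Import all_boot all_order all_algebra.
From mathcomp Require Import mpoly.
From Stdlib Require Import Classical ClassicalEpsilon.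

Set Implicit Arguments.
Unset Strict Implicit.
Unset Printing Implicit Defensive.

Import Order.TTheory GRing.Theory Num.Theory.
Local Open Scope ring_scope.

Lemma dickson (T : eqType) (f : nat -> T -> nat) (k : nat) (A : T -> Prop) :
  exists2 s : seq T, forall v, v \in s -> A v &
    forall u, A u ->
      exists2 v, v \in s & forall j, (j < k)%N -> (f j v <= f j u)%N.
Proof.
elim: k A => [|k IHk] A.
  have [[u Au]|nA] := classic (exists u, A u).
    exists [:: u] => [v|v _]; first by rewrite inE => /eqP ->.
    by exists u; rewrite ?mem_head.
  by exists [::] => // u Au; case: nA; exists u.
have [s0 s0A s0P] := IHk A.
pose M := \max_(v <- s0) f k v.
have [s1 s1A s1P] : exists2 s : seq T, forall v, v \in s -> A v &
    forall u, A u -> (f k u < M)%N ->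
      exists2 v, v \in s & forall j, (j < k.+1)%N -> (f j v <= f j u)%N.
  elim: M => [|M [s sA sP]]; first by exists [::].
  have [t tA tP] := IHk (fun u => A u /\ f k u = M).
  exists (s ++ t) => [v|u Au].
    by rewrite mem_cat => /orP[/sA|/tA[]].
  rewrite ltnS leq_eqVlt => /orP[/eqP uM|uM].
    have [v vt vP] := tP u (conj Au uM).
    exists v; first by rewrite mem_cat vt orbT.
    move=> j; rewrite ltnS leq_eqVlt => /orP[/eqP ->|/vP //].
    by have [_ ->] := tA v vt; rewrite uM.
  have [v vs vP] := sP u Au uM.
  by exists v; rewrite ?mem_cat ?vs.
exists (s0 ++ s1) => [v|u Au].
  by rewrite mem_cat => /orP[/s0A|/s1A].
have [uM|Mu] := ltnP (f k u) M.
  by have [v vs vP] := s1P u Au uM; exists v; rewrite ?mem_cat ?vs ?orbT.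
have [v vs vP] := s0P u Au; exists v; first by rewrite mem_cat vs.
move=> j; rewrite ltnS leq_eqVlt => /orP[/eqP ->|/vP //].
by apply: leq_trans Mu; apply: (@leq_bigmax_seq _ s0 xpredT (f k)).
Qed.

(* S = K[X_1, ..., X_n] is {mpoly K[n]}, the variables being indexed by 'I_n,
   that is, from 0 to n - 1; a monomial is represented by its exponent vector
   u : 'X_{1..n}, so that u j is nu_j(u). *)
Section MonomialIdeals.
Variables (K : fieldType) (n : nat).
Implicit Types (I : {mpoly K[n]} -> Prop) (A : 'X_{1..n} -> Prop).
Implicit Types (G : seq 'X_{1..n}) (u v : 'X_{1..n}).

Definition monomial_span A (p : {mpoly K[n]}) : Prop :=
  exists2 s : seq ({mpoly K[n]} * 'X_{1..n}),
    forall x, x \in s -> A x.2 & p = \sum_(x <- s) x.1 * 'X_[x.2].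

Definition monomial_ideal I : Prop :=
  exists A, forall p, I p <-> monomial_span A p.

Definition generates G I : Prop :=
  forall p, I p <-> monomial_span (fun u => u \in G) p.

Definition is_mingens G I : Prop :=
  [/\ uniq G, generates G I &
      forall G', {subset G' <= G} -> generates G' I -> {subset G <= G'}].

(* G(I), as a duplicate-free list; see mingensP for the existence. *)
Definition mingens I : seq 'X_{1..n} :=
  epsilon (inhabits [::]) (fun G => is_mingens G I).

Definition supp u : {set 'I_n} := [set j | u j != 0%N].

Definition mingens0 I : seq 'X_{1..n} :=
  [seq u <- mingens I | (2 <= #|supp u|)%N].

(* rho_j; it is 0 when G(I) is empty. *)
Definition rho I (j : 'I_n) : nat := \max_(u <- mingens I) u j.

Definition is_face I (F : {set 'I_n}) : Prop :=
  forall u, u \in mingens I -> ~~ (supp u \subset F).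

Definition face_dim (F : {set 'I_n}) : int := #|F|%:Z - 1.

Lemma monomial_spanD A p q :
  monomial_span A p -> monomial_span A q -> monomial_span A (p + q).
Proof.
move=> [s sA ->] [t tA ->]; exists (s ++ t); last by rewrite big_cat.
by move=> x; rewrite mem_cat => /orP[/sA|/tA].
Qed.

Lemma monomial_spanM A p q : monomial_span A p -> monomial_span A (q * p).
Proof.
move=> [s sA ->]; exists [seq (q * x.1, x.2) | x <- s].
  by move=> _ /mapP[x /sA ? ->].
by rewrite big_map big_distrr; apply: eq_bigr => x _; rewrite /= mulrA.
Qed.

Lemma monomial_span_le A B :
  (forall u, A u -> exists2 v, B v & (v <= u)%MM) ->
  forall p, monomial_span A p -> monomial_span B p.
Proof.
move=> AB p [s + ->]; elim: s => [|x s IHs] sA.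
  by exists [::] => //; rewrite !big_nil.
rewrite big_cons; apply: monomial_spanD; last first.
  by apply: IHs => y ys; apply: sA; rewrite inE ys orbT.
apply: monomial_spanM; have [v Bv vx] := AB _ (sA _ (mem_head _ _)).
exists [:: ('X_[x.2 - v], v)]; first by move=> y; rewrite inE => /eqP ->.
by rewrite big_seq1 /= -mpolyXD submK.
Qed.

Lemma monomial_ideal_fg I : monomial_ideal I -> exists G, generates G I.
Proof.
move=> [A IA].
have [s sA sP] := @dickson 'X_{1..n} (fun j u => nth 0%N (u : 'X_{1..n}) j) n A.
exists s => p; rewrite IA; split; apply: monomial_span_le => u.
  move=> /sP[v vs vP]; exists v => //; apply/mnm_lepP => j.
  by rewrite !(mnm_nth 0%N); apply: vP (ltn_ord j).
by move=> /sA Au; exists u => //; apply/mnm_lepP.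
Qed.

Lemma mingensP I : monomial_ideal I -> is_mingens (mingens I) I.
Proof.
move=> /monomial_ideal_fg genI.
apply: (epsilon_spec (inhabits [::]) (fun G => is_mingens G I)).
have eqgen G G' : G =i G' -> generates G I -> generates G' I.
  move=> eG GI p; rewrite GI; split; apply: monomial_span_le => u uG.
    by exists u; rewrite -?eG //; apply/mnm_lepP.
  by exists u; rewrite ?eG //; apply/mnm_lepP.
have [N [[G sG GI] minN]] : exists N : nat,
    (exists2 G, size G = N & generates G I) /\
    forall G, generates G I -> (N <= size G)%N.
  have [G] := genI; have [N] := ubnP (size G); elim: N G => // N IHN G ltGN GI.
  have [[G' ltG' G'I]|minG] :=
      classic (exists2 G', (size G' < size G)%N & generates G' I).
    by apply: (IHN G') => //; apply: leq_trans ltG' _.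
  exists (size G); split; first by exists G.
  move=> G' G'I; rewrite leqNgt; apply/negP => ltG'.
  by apply: minG; exists G'.
have uI : generates (undup G) I by apply: eqgen GI => u; rewrite mem_undup.
exists (undup G); split=> // [|G' sub G'I]; first exact: undup_uniq.
have vI : generates (undup G') I by apply: eqgen G'I => u; rewrite mem_undup.
have le1 : (size (undup G) <= size (undup G'))%N.
  by apply: leq_trans (minN _ vI); rewrite -sG size_undup.
have [|_ e] := uniq_min_size (undup_uniq G') _ le1.
  by move=> u; rewrite mem_undup => /sub.
by move=> u; rewrite -e mem_undup.
Qed.

End MonomialIdeals.

(* For submodules B <= Z of V, the quotient Z / B has finite length: by the
   correspondence theorem a strict chain of submodules of Z / B is a strict
   chain of submodules of V between B and Z, and the length of a module is the
   supremum of the lengths of its strict chains of submodules. *)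
Section Length.
Variables (R : pzRingType) (V : lmodType R).

Definition submodule (N : V -> Prop) : Prop :=
  [/\ N 0, forall x y, N x -> N y -> N (x + y) &
      forall (r : R) x, N x -> N (r *: x)].

Definition subset_of (M N : V -> Prop) : Prop := forall x, M x -> N x.

Definition finite_length_quotient (Z B : V -> Prop) : Prop :=
  exists len : nat, forall (k : nat) (N : nat -> V -> Prop),
    (forall j, (j <= k)%N ->
       [/\ submodule (N j), subset_of B (N j) & subset_of (N j) Z]) ->
    (forall j, (j < k)%N ->
       subset_of (N j) (N j.+1) /\ ~ subset_of (N j.+1) (N j)) ->
    (k <= len)%N.

End Length.

(* H^t_m(S/I) is the t-th cohomology of the Cech complex of S/I with respect to
   the images of X_1, ..., X_n,
     C^t = \bigoplus_(#|F| = t) (S/I)_{x_F},   x_F = \prod_(j in F) X_j.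
   By exactness of localization (S/I)_{x_F} = S_{x_F} / I S_{x_F}, and S_{x_F}
   is a subring of the fraction field of S. Hence C^t is the quotient of the
   families z in Frac(S)^{F <= [n]} with z_F in S_{x_F} for #|F| = t and z_F = 0
   otherwise, by those families with z_F in I S_{x_F}; its cohomology is the
   quotient of S-submodules cech_cocycle / cech_coboundary of Frac(S)^{F <= [n]}.
   As I annihilates it, its lengths over S and over S/I agree. *)
Definition cochain (K : fieldType) (n : nat) : Type :=
  {ffun {set 'I_n} -> {fraction {mpoly K[n]}}}.

HB.instance Definition _ (K : fieldType) (n : nat) :=
  GRing.Zmodule.on (cochain K n).

Section Cochain.
Variables (K : fieldType) (n : nat).

Definition scale_cochain (p : {mpoly K[n]}) (z : cochain K n) : cochain K n :=
  [ffun F => tofrac p * z F].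

Fact scale_cochainA p q z :
  scale_cochain p (scale_cochain q z) = scale_cochain (p * q) z.
Proof. by apply/ffunP => F; rewrite !ffunE rmorphM mulrA. Qed.

Fact scale_cochain1 : left_id 1 scale_cochain.
Proof. by move=> z; apply/ffunP => F; rewrite !ffunE rmorph1 mul1r. Qed.

Fact scale_cochainDr : right_distributive scale_cochain +%R.
Proof. by move=> p y z; apply/ffunP => F; rewrite !ffunE mulrDr. Qed.

Fact scale_cochainDl z : {morph scale_cochain^~ z : p q / p + q}.
Proof. by move=> p q; apply/ffunP => F; rewrite !ffunE rmorphD mulrDl. Qed.

HB.instance Definition _ :=
  GRing.Zmodule_isLmodule.Build {mpoly K[n]} (cochain K n)
    scale_cochainA scale_cochain1 scale_cochainDr scale_cochainDl.

Implicit Types (I : {mpoly K[n]} -> Prop) (F : {set 'I_n}) (z : cochain K n).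

Definition xprod F : {mpoly K[n]} := \prod_(j in F) 'X_j.

(* The localization I S_{x_F}; S_{x_F} itself is the case of the unit ideal. *)
Definition localized I F (y : {fraction {mpoly K[n]}}) : Prop :=
  exists (p : {mpoly K[n]}) (k : nat),
    I p /\ y = tofrac p / tofrac (xprod F ^+ k).

Definition cech_chain I (t : nat) z : Prop :=
  forall F, if #|F| == t then localized I F (z F) else z F = 0.

Definition cech_diff z : cochain K n :=
  [ffun F : {set 'I_n} =>
     \sum_(j in F) (-1) ^+ #|[set k in F | (k < j)%N]| * z (F :\ j)].

Definition cech_cocycle I (t : nat) z : Prop :=
  cech_chain (fun _ => True) t z /\ cech_chain I t.+1 (cech_diff z).

Definition cech_coboundary I (t : nat) z : Prop :=
  if t is s.+1 then
    exists2 y, cech_chain (fun _ => True) s y &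
               cech_chain I t (z - cech_diff y)
  else cech_chain I 0 z.

Definition local_cohomology_finite_length I (t : nat) : Prop :=
  @finite_length_quotient {mpoly K[n]} (cochain K n)
    (cech_cocycle I t) (cech_coboundary I t).

End Cochain.

Section ExponentVectors.
Variables (K : fieldType) (n : nat).
Implicit Types (I : {mpoly K[n]} -> Prop) (a b : {ffun 'I_n -> int}).

Definition le_vec a b : Prop := forall j, a j <= b j.

Definition rho_pred I : {ffun 'I_n -> int} := [ffun j => (rho I j)%:Z - 1].

Definition Lset a (u : 'X_{1..n}) : {set 'I_n} := [set j | a j < (u j)%:Z].

(* a(sigma) *)
Definition subst_rho I a (sigma : {set 'I_n}) : {ffun 'I_n -> int} :=
  [ffun j => if j \in sigma then (rho I j)%:Z else a j].

Definition admissible I (sigma : {set 'I_n}) a : Prop :=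
  [/\ le_vec [ffun => 0] a, le_vec a (rho_pred I) &
      forall u, u \in mingens0 I -> Lset (subst_rho I a sigma) u != set0].

Definition maximal_admissible I (sigma : {set 'I_n}) a : Prop :=
  forall a', admissible I sigma a' ->
    le_vec (subst_rho I a sigma) (subst_rho I a' sigma) ->
    subst_rho I a' sigma = subst_rho I a sigma.

(* G(I) = {X_{m+1}^{rho_{m+1}}, ..., X_n^{rho_n}} \cup G_0(I) with m <= n; with
   indices starting from 0, the pure powers are those of the X_j, m <= j. *)
Definition pure_powers_from I (m : nat) : Prop :=
  (m <= n)%N /\
  forall u, u \in mingens I <->
    (exists2 j : 'I_n, (m <= j)%N & u = (U_(j) *+ rho I j)%MM)
    \/ u \in mingens0 I.

End ExponentVectors.

(* Main.v *)
From HB Require Import structures.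
Require Import Defs.
From mathcomp Require Import all_boot all_order all_algebra.
From mathcomp Require Import mpoly.
From mathcomp Require Import zify.
From Stdlib Require Import Classical.

Set Implicit Arguments.
Unset Strict Implicit.
Unset Printing Implicit Defensive.

Import Order.TTheory GRing.Theory Num.Theory.
Local Open Scope ring_scope.

(** Let [sigma] be a face with [i] elements, and let [b] be the exponent vector
    that agrees with [a] outside [sigma] and vanishes on [sigma].  Write [x_F]
    for the product of the [X_j] with [j] in [F].  Everything rests on the
    Laurent monomials [X^b / x_sigma^k].

    By (a), (b) and since [sigma] is a face, every minimal generator [u] has an
    index outside [sigma] at which it exceeds [a]; so no monomial of
    [I S_{x_sigma}] has the exponents of [X^b] outside [sigma].  Consider the
    cochain [x_k] that takes the value [X^b / x_sigma^k] at [sigma] and [0]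
    elsewhere.

    Suppose that for each [l] outside [sigma] some generator is bounded by [a]
    outside [l |: sigma].  Then [X^b] lies in [I S_{x_F}] for [F = l |: sigma],
    which says that [x_k] is a cocycle ([witness_cocycle]).  For [k > 0] it is
    not a coboundary, not even modulo [S x_(k-1)]: the value at [sigma] of a
    coboundary is a sum of elements of the [S_{x_{sigma - j}}] and of
    [I S_{x_sigma}], and neither in these nor in [S X^b / x_sigma^(k-1)] does
    the Laurent monomial [X^b / x_sigma^k] occur ([witness_not_coboundary]).  As
    [x_sigma x_(k+1) = x_k], the submodules generated by the [x_k] form an
    infinite strictly increasing chain in the local cohomology, against finite
    length ([local_cohomology_infinite_length]).

    Hence there is an [l] outside [sigma] such that every generator exceeds [a]
    somewhere outside [l |: sigma].  This is (ii); it also forces [l < m],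
    since a pure power of [X_l] is supported on [l] alone.  Finally, none of
    these indices is [l], so raising the coordinate [a_l] by one preserves (b);
    by maximality it has to violate (a), and this is (i). *)

(** * Modules of infinite length *)

Section Submodules.
Variables (R : pzRingType) (V : lmodType R).
Implicit Types (N Z B : V -> Prop).

(** Since [x k] is a multiple of [x k.+1], the submodules [B + R (x k)]
    increase with [k]; they do so strictly because [x k.+1] is not in
    [B + R (x k)]. *)
Lemma infinite_length_quotient Z B (x : nat -> V) (r : R) :
    submodule Z -> submodule B -> subset_of B Z ->
    (forall k, Z (x k)) -> (forall k, r *: x k.+1 = x k) ->
    (forall k s, ~ B (x k.+1 - s *: x k)) ->
  ~ finite_length_quotient Z B.
Proof.
move=> subZ subB BZ Zx rx xB [len].
have [[_ ZD ZZ] [B0 BD BZ']] := (subZ, subB).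
pose N k z := exists s, B (z - s *: x k).
move=> /(_ len.+1 N); rewrite ltnn => absurd.
suff: false by []; apply: absurd => j _; split.
- split=> [|y z [s Bs] [t Bt]|q z [s Bs]].
  + by exists 0; rewrite scale0r subr0.
  + by exists (s + t); rewrite scalerDl opprD addrACA; apply: BD.
  + by exists (q * s); rewrite -scalerA -scalerBr; apply: BZ'.
- by move=> z Bz; exists 0; rewrite scale0r subr0.
- move=> z [s /BZ]; move/ZD => /(_ (s *: x j)).
  by rewrite subrK; apply; apply: ZZ.
- by move=> z [s]; rewrite -rx scalerA => Bs; exists (s * r).
- move=> /(_ (x j.+1)) []; first by exists 1; rewrite scale1r subrr.
  by move=> s; apply: xB.
Qed.

End Submodules.

(** * Monomials and Laurent polynomials *)

Section Monomials.
Variables (K : fieldType) (n : nat).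
Implicit Types (I : {mpoly K[n]} -> Prop) (A : 'X_{1..n} -> Prop).
Implicit Types (u w b c e : 'X_{1..n}) (p q : {mpoly K[n]}).
Implicit Types (F G : {set 'I_n}) (y z : {fraction {mpoly K[n]}}).

Lemma mcoeffMX_if p e w :
  (p * 'X_[e])@_w = if (e <= w)%MM then p@_(w - e) else 0.
Proof.
case: ifPn => [le|nle].
  by rewrite -{1}(submK le) addmC mcoeffMX.
rewrite mcoeffM big1 // => k /eqP wk; rewrite mcoeffX.
case: eqP => [ek|]; last by rewrite mulr0.
case/negP: nle; apply/mnm_lepP => j.
by rewrite wk ek mnmDE leq_addl.
Qed.

(** The easy half of the fact that membership in a monomial ideal can be tested
    monomial by monomial. *)
Lemma mcoeff_span A p w :
  monomial_span A p -> p@_w != 0 -> exists2 u, A u & (u <= w)%MM.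
Proof.
move=> [s sA ->]; rewrite raddf_sum /=.
elim: s sA => [|x s IHs] sA; first by rewrite big_nil eqxx.
rewrite big_cons mcoeffMX_if; case: ifPn => [le _|_].
  by exists x.2 => //; apply: sA; rewrite mem_head.
by rewrite add0r; apply: IHs => y ys; apply: sA; rewrite inE ys orbT.
Qed.

Lemma span_mpolyX A u w :
  A u -> (u <= w)%MM -> monomial_span A ('X_[w] : {mpoly K[n]}).
Proof.
move=> Au le; exists [:: ('X_[w - u], u)].
  by move=> x; rewrite inE => /eqP ->.
by rewrite big_seq1 /= -mpolyXD submK.
Qed.

Lemma monomial_ideal_submodule I :
  monomial_ideal I -> @submodule {mpoly K[n]} ({mpoly K[n]})^o I.
Proof.
move=> [A IA]; split=> [|p q|r p]; rewrite !IA.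
- by exists [::] => //; rewrite big_nil.
- exact: monomial_spanD.
- exact: monomial_spanM.
Qed.

Lemma mulmnDr u k l : (u *+ (k + l) = u *+ k + u *+ l)%MM.
Proof. by apply/mnmP => j; rewrite mnmDE !mulmnE mulnDr. Qed.

Definition ind_mnm F : 'X_{1..n} := [multinom (j \in F : nat) | j < n].

Lemma xprodXE F k : xprod K F ^+ k = 'X_[ind_mnm F *+ k].
Proof.
rewrite -mpolyXn; congr (_ ^+ _); rewrite /xprod mprodXE; congr 'X_[_].
apply/mnmP => j; rewrite mnm_sumE mnmE.
case: (boolP (j \in F)) => jF.
  rewrite (bigD1 j) //= mnm1E eqxx big1 ?addn0 // => l /andP[_ /negPf].
  by rewrite mnm1E => ->.
rewrite big1 // => l lF; rewrite mnm1E; case: eqP => // lj.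
by rewrite -lj lF in jF.
Qed.

(** Laurent polynomials are handled as such fractions: unlike the powers of the
    various [xprod F], the denominators [X^e] are closed under products. *)
Definition mfrac (p : {mpoly K[n]}) e : {fraction {mpoly K[n]}} :=
  tofrac p / tofrac 'X_[e].

Lemma tofracX_neq0 e : tofrac ('X_[e] : {mpoly K[n]}) != 0.
Proof.
rewrite tofrac_eq0; apply/eqP => /(congr1 (mcoeff e))/eqP.
by rewrite mcoeff0 mcoeffX eqxx oner_eq0.
Qed.

Lemma mfracD p q e f :
  mfrac p e + mfrac q f = mfrac (p * 'X_[f] + q * 'X_[e]) (e + f).
Proof.
by rewrite /mfrac addf_div ?tofracX_neq0 // mpolyXD tofracD !tofracM.
Qed.

Lemma mfracM p q e f : mfrac p e * mfrac q f = mfrac (p * q) (e + f).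
Proof. by rewrite /mfrac mulf_div mpolyXD !tofracM. Qed.

Lemma mfracMX p e f : mfrac (p * 'X_[f]) (e + f) = mfrac p e.
Proof.
rewrite -mfracM -[RHS]mulr1; congr (_ * _).
by rewrite /mfrac divff ?tofracX_neq0.
Qed.

Lemma eq_mfrac p q e f : mfrac p e = mfrac q f -> p * 'X_[f] = q * 'X_[e].
Proof.
move/eqP; rewrite /mfrac eqr_div ?tofracX_neq0 // -!tofracM tofrac_eq.
by move/eqP.
Qed.

Lemma localizedE I F y :
  localized I F y <-> exists p k, I p /\ y = mfrac p (ind_mnm F *+ k).
Proof.
by split=> -[p [k [Ip ->]]]; exists p, k; rewrite /mfrac xprodXE.
Qed.

Section Localized.
Variables (I : {mpoly K[n]} -> Prop).
Hypothesis (subI : @submodule {mpoly K[n]} ({mpoly K[n]})^o I).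

Lemma localized0 F : localized I F 0.
Proof.
case: subI => I0 _ _; apply/localizedE.
by exists 0, 0%N; rewrite /mfrac tofrac0 mul0r.
Qed.

Lemma localizedD F y z :
  localized I F y -> localized I F z -> localized I F (y + z).
Proof.
case: subI => _ ID IM /localizedE[p [k [Ip ->]]] /localizedE[q [l [Iq ->]]].
apply/localizedE; rewrite mfracD -mulmnDr; do 2!eexists; split=> //.
by apply: ID; rewrite mulrC; apply: IM.
Qed.

(** [I S_{x_F}] is an ideal of [S_{x_F}] and contains [I S_{x_G}]. *)
Lemma localizedM F G y z :
  G \subset F -> localized I G y -> localized (fun=> True) F z ->
  localized I F (y * z).
Proof.
case: subI => _ _ IM GF /localizedE[p [k [Ip ->]]] /localizedE[q [l [_ ->]]].
apply/localizedE; exists ('X_[ind_mnm (F :\: G) *+ k] * (p * q)), (k + l)%N.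
(* p / x_G^k is expanded by x_(F - G)^k to get the denominator x_F^k. *)
split; first by apply: (IM); rewrite mulrC; apply: IM.
rewrite mfracM -(mfracMX _ _ (ind_mnm (F :\: G) *+ k)) [in RHS]mulrC.
congr mfrac; apply/mnmP => j; rewrite !(mnmDE, mulmnE, mnmE) inE.
by case: (boolP (j \in G)) => [/(subsetP GF) -> | _]; case: (j \in F) => /=; lia.
Qed.

Lemma localizedS F G y : G \subset F -> localized I G y -> localized I F y.
Proof.
move=> GF Iy; rewrite -[y]mulr1; apply: localizedM GF Iy _.
apply/localizedE; exists 1, 0%N.
by rewrite mulm0n /mfrac mpolyX0 divff // tofrac1 oner_eq0.
Qed.

Lemma localizedZ F p y : localized I F y -> localized I F (tofrac p * y).
Proof.
move=> Iy; rewrite mulrC; apply: localizedM (subxx F) Iy _; apply/localizedE.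
by exists p, 0%N; rewrite mulm0n /mfrac mpolyX0 tofrac1 divr1.
Qed.

Lemma localized_sign F k y : localized I F y -> localized I F ((-1) ^+ k * y).
Proof. by rewrite -tofrac1 -tofracN -tofracXn; apply: localizedZ. Qed.

Lemma localized_sum F (J : Type) (r : seq J) (P : pred J) (f : J -> _) :
  (forall j, P j -> localized I F (f j)) ->
  localized I F (\sum_(j <- r | P j) f j).
Proof.
by move=> If; apply: big_ind => //; [apply: localized0 | apply: localizedD].
Qed.

End Localized.

(** The coefficient of the Laurent monomial [X^b / X^c] in the Laurent
    polynomial [y] is zero.  As [X^w / X^e = X^b / X^c] reads [w + c = b + e],
    integer exponents are avoided.  Asking this of one representation [p / X^e]
    of [y] is enough, as all of them give the same coefficient. *)
Definition vanishing_coef b c y : Prop :=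
  exists p e, y = mfrac p e /\ forall w, (w + c = b + e)%MM -> p@_w = 0.

Lemma vanishing_coefD b c y z :
  vanishing_coef b c y -> vanishing_coef b c z -> vanishing_coef b c (y + z).
Proof.
have aux p e f w :
    (forall w, (w + c = b + e)%MM -> p@_w = 0) ->
    (w + c = b + (e + f))%MM -> (p * 'X_[f])@_w = 0.
  move=> p0 wE; rewrite mcoeffMX_if; case: ifP => // le; apply: p0.
  by apply: (@addIm _ f); rewrite -!addmA [(c + f)%MM]addmC addmA submK.
move=> [p [e [-> p0]]] [q [f [-> q0]]]; rewrite mfracD.
do 2!eexists; split; first by [].
move=> w wE.
rewrite mcoeffD (aux p e) // (aux q f) ?addr0 //.
by rewrite [(f + e)%MM]addmC.
Qed.

Lemma vanishing_coefN b c y : vanishing_coef b c y -> vanishing_coef b c (- y).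
Proof.
move=> [p [e [-> p0]]]; exists (- p), e; split.
  by rewrite /mfrac tofracN mulNr.
by move=> w /p0; rewrite mcoeffN => ->; rewrite oppr0.
Qed.

Lemma vanishing_coef0 b c : vanishing_coef b c 0.
Proof.
exists 0, 0%MM; split; last by move=> w _; rewrite mcoeff0.
by rewrite /mfrac tofrac0 mul0r.
Qed.

Lemma nonvanishing_coef b c : ~ vanishing_coef b c (mfrac 'X_[b] c).
Proof.
move=> [p [e [/eq_mfrac + p0]]] => /(congr1 (mcoeff (b + e))).
rewrite -mpolyXD mcoeffX eqxx mcoeffMX_if; case: ifP => [le|_ /eqP]; last first.
  by rewrite oner_eq0.
by rewrite p0 ?submK // => /eqP; rewrite oner_eq0.
Qed.

End Monomials.

(** * The Cech complex *)

Section Cech.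
Variables (K : fieldType) (n : nat).
Implicit Types (I : {mpoly K[n]} -> Prop) (F : {set 'I_n}) (z : cochain K n).

Lemma scale_cochainE (p : {mpoly K[n]}) z F : (p *: z) F = tofrac p * z F.
Proof. by rewrite [_ *: _]/(scale_cochain p z) ffunE. Qed.

Lemma cech_diff_is_linear : linear (@cech_diff K n).
Proof.
move=> r y z; apply/ffunP => F; rewrite [RHS]ffunE scale_cochainE !ffunE.
rewrite big_distrr -big_split; apply: eq_bigr => j _ /=.
by rewrite ffunE scale_cochainE mulrDr mulrCA.
Qed.

HB.instance Definition _ :=
  GRing.isLinear.Build {mpoly K[n]} (cochain K n) (cochain K n) _
    (@cech_diff K n) cech_diff_is_linear.

(** The face [F :\ j :\ k] occurs twice in the double sum, once for each order
    of removal, with opposite signs. *)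
Lemma cech_diff_diff z : cech_diff (cech_diff z) = 0.
Proof.
apply/ffunP => F; rewrite !ffunE.
pose s F (j : 'I_n) : {fraction {mpoly K[n]}} :=
  (-1) ^+ #|[set k : 'I_n in F | (k < j)%N]|.
pose g j k := s F j * (s (F :\ j) k * z (F :\ j :\ k)).
have -> : \sum_(j in F) (-1) ^+ #|[set k in F | (k < j)%N]|
                         * cech_diff z (F :\ j)
    = \sum_(j in F) \sum_(k in F | (k < j)%N) g j k
     + \sum_(j in F) \sum_(k in F | (j < k)%N) g j k.
  rewrite -big_split; apply: eq_bigr => j jF /=.
  rewrite ffunE big_distrr /= (bigID (fun k : 'I_n => (k < j)%N)) /=.
  congr (_ + _); apply: eq_bigl => k; rewrite !inE -(inj_eq val_inj) /=.
    by case: (ltngtP k j) => _; rewrite ?andbF ?andbT.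
  by case: (ltngtP k j) => _; rewrite ?andbF ?andbT.
rewrite [X in _ + X](exchange_big_dep (fun k => k \in F)) /=; last first.
  by move=> ? ? _ /andP[].
rewrite -big_split big1 // => j jF /=.
rewrite [X in _ + X](eq_bigl (fun k => (k \in F) && (k < j)%N)); last first.
  by move=> k; rewrite jF.
rewrite -big_split big1 // => k /andP[kF kj] /=.
rewrite /g [F :\ k :\ j]setDDl setUC -setDDl.
(* For k < j in F, removing j leaves the sign at k unchanged and removing k
   flips the sign at j, so the two terms for {j, k} cancel. *)
have -> : s (F :\ j) k = s F k.
  rewrite /s; congr (_ ^+ #|pred_of_set _|); apply/setP => l.
  rewrite !inE -(inj_eq val_inj) /=.
  by case: (l \in F); rewrite ?andbF //= ?andbT; lia.
have -> : s F j = - s (F :\ k) j.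
  rewrite /s (cardsD1 k) !inE kF kj exprS mulN1r.
  congr (- (_ ^+ #|pred_of_set _|)).
  by apply/setP => l; rewrite !inE andbA.
by rewrite mulNr mulrCA addNr.
Qed.

Lemma cech_chain_submodule I t :
  @submodule {mpoly K[n]} ({mpoly K[n]})^o I -> submodule (cech_chain I t).
Proof.
move=> subI; split=> [F|y z cy cz F|r z cz F].
- by rewrite ffunE; case: ifP => // _; apply: localized0.
- move: (cy F) (cz F); rewrite ffunE; case: ifP => _; first exact: localizedD.
  by move=> -> ->; rewrite addr0.
- move: (cz F); rewrite scale_cochainE; case: ifP => _; first exact: localizedZ.
  by move=> ->; rewrite mulr0.
Qed.

Lemma cech_diff_chain I t z :
    @submodule {mpoly K[n]} ({mpoly K[n]})^o I ->
    (forall F, #|F| != t -> z F = 0) ->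
    (forall F j, j \in F -> #|F :\ j| = t -> localized I F (z (F :\ j))) ->
  cech_chain I t.+1 (cech_diff z).
Proof.
move=> subI z0 zI F; rewrite ffunE.
have cF j : j \in F -> #|F| = #|F :\ j|.+1 by move=> jF; rewrite (cardsD1 j) jF.
case: eqP => [Ft|/eqP Ft].
  apply: localized_sum => // j jF; apply: localized_sign => //; apply: zI => //.
  by apply: succn_inj; rewrite -cF.
rewrite big1 // => j jF; rewrite z0 ?mulr0 //.
by apply: contra Ft => /eqP <-; rewrite (cF j).
Qed.

Lemma cech_chain_diff I t z :
  @submodule {mpoly K[n]} ({mpoly K[n]})^o I ->
  cech_chain I t z -> cech_chain I t.+1 (cech_diff z).
Proof.
move=> subI cz; apply: cech_diff_chain => // [F /negPf Ft|F j _ Ft].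
  by have := cz F; rewrite Ft.
by have := cz (F :\ j); rewrite Ft eqxx; apply: localizedS => //; apply: subsetDl.
Qed.

Lemma unit_ideal_submodule :
  @submodule {mpoly K[n]} ({mpoly K[n]})^o (fun _ => True).
Proof. by []. Qed.

Lemma cech_chain_True I t z :
  cech_chain I t z -> cech_chain (fun _ => True) t z.
Proof.
move=> cz F; move: (cz F); case: ifP => // _ [p [k [_ ->]]].
by exists p, k.
Qed.

Section Ideal.
Variables (I : {mpoly K[n]} -> Prop).
Hypothesis (subI : @submodule {mpoly K[n]} ({mpoly K[n]})^o I).

Lemma cech_cocycle_submodule t : submodule (cech_cocycle I t).
Proof.
have [C0 CD CZ] := cech_chain_submodule t unit_ideal_submodule.
have [D0 DD DZ] := cech_chain_submodule t.+1 subI.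
split=> [|y z [cy dy] [cz dz]|r z [cz dz]];
  split; rewrite ?linear0 ?linearD ?linearZ //.
- exact: CD.
- exact: DD.
- exact: CZ.
- exact: DZ.
Qed.

Lemma cech_coboundary_submodule t : submodule (cech_coboundary I t).
Proof.
case: t => [|t]; first exact: cech_chain_submodule.
have [C0 CD CZ] := cech_chain_submodule t unit_ideal_submodule.
have [D0 DD DZ] := cech_chain_submodule t.+1 subI.
rewrite /cech_coboundary; split=> /= [|y z [y' cy dy] [z' cz dz]|r z [z' cz dz]].
- exists 0; first exact: C0. by rewrite linear0 subr0.
- exists (y' + z'); first exact: CD.
  by rewrite linearD opprD addrACA; apply: DD.
- exists (r *: z'); first exact: CZ.
  by rewrite linearZ -scalerBr; apply: DZ.
Qed.

Lemma cech_coboundary_cocycle t :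
  subset_of (cech_coboundary I t) (cech_cocycle I t).
Proof.
have [C0 CD CZ] := cech_chain_submodule t unit_ideal_submodule.
move=> z; case: t C0 CD CZ => [|t] C0 CD CZ.
  by move=> cz; split; [apply: cech_chain_True cz | apply: cech_chain_diff].
move=> [y cy dy]; split.
  rewrite -[z](subrK (cech_diff y)); apply: CD; first exact: cech_chain_True dy.
  by apply: cech_chain_diff => //; apply: unit_ideal_submodule.
by have := cech_chain_diff subI dy; rewrite linearB /= cech_diff_diff subr0.
Qed.

End Ideal.

(** * A Laurent monomial generating infinitely many classes *)

Definition single_cochain (sigma : {set 'I_n}) y : cochain K n :=
  [ffun F => if F == sigma then y else 0].

Lemma scale_single p sigma y :
  p *: single_cochain sigma y = single_cochain sigma (tofrac p * y).
Proof.
by apply/ffunP => F; rewrite scale_cochainE !ffunE; case: eqP; rewrite ?mulr0.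
Qed.

Section Witness.
Variables (I : {mpoly K[n]} -> Prop) (A : 'X_{1..n} -> Prop).
Hypothesis (IA : forall p, I p <-> monomial_span A p).
Variables (sigma : {set 'I_n}) (b : 'X_{1..n}).

Let subI : @submodule {mpoly K[n]} ({mpoly K[n]})^o I.
Proof. by apply: monomial_ideal_submodule; exists A. Qed.

Let x k := single_cochain sigma (mfrac 'X_[b] (ind_mnm sigma *+ k)).

(** The coboundary of [x k] lives on the sets [F = l |: sigma], where its value
    [X^b / x_sigma^k] lies in [I S_{x_F}] because a large power of [x_F] lifts
    [X^b] above the generator [u]. *)
Lemma witness_cocycle k :
    (forall l, l \notin sigma ->
       exists2 u, A u & forall r, r \notin l |: sigma -> (u r <= b r)%N) ->
  cech_cocycle I #|sigma| (x k).
Proof.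
move=> below; split.
  move=> F; rewrite ffunE; case: (F =P sigma) => [->|_]; last first.
    by case: ifP => // _; apply: localized0; apply: unit_ideal_submodule.
  by rewrite eqxx; apply/localizedE; exists 'X_[b], k.
apply: cech_diff_chain => // F.
  by rewrite ffunE; case: (F =P sigma) => [->|//]; rewrite eqxx.
move=> l lF _; rewrite ffunE; case: eqP => [E|_]; last exact: localized0.
have lsigma : l \notin sigma by rewrite -E !inE eqxx.
have EF : F = l |: sigma by rewrite -E setD1K.
have [u Au uP] := below l lsigma.
pose M := (\max_j u j)%N.
have -> : mfrac 'X_[b] (ind_mnm sigma *+ k)
    = mfrac 'X_[b] 0 * mfrac (1 : {mpoly K[n]}) (ind_mnm sigma *+ k).
  by rewrite mfracM mulr1 add0m.
apply: (localizedM subI (subxx F)); last first.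
  apply: (@localizedS _ _ _ unit_ideal_submodule F sigma).
    by rewrite EF subsetUr.
  by apply/localizedE; exists 1, k.
apply/localizedE; exists ('X_[b] * 'X_[ind_mnm F *+ M]), M.
split; last by rewrite -(mfracMX _ 0 (ind_mnm F *+ M)) add0m.
rewrite -mpolyXD; apply/IA; apply: (span_mpolyX K Au).
apply/mnm_lepP => r; rewrite mnmDE mulmnE mnmE.
case: (boolP (r \in F)) => [_|]; last by rewrite EF mul0n addn0; apply: uP.
by rewrite mul1n (leq_trans _ (leq_addl _ _)) //; apply: leq_bigmax.
Qed.

Lemma scale_witness k : xprod K sigma *: x k.+1 = x k.
Proof.
rewrite scale_single; congr single_cochain.
rewrite -[xprod _ _]expr1 xprodXE.
rewrite -[RHS](mfracMX _ _ (ind_mnm sigma *+ 1)) -mulmnDr addn1.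
by rewrite /mfrac mulrA -tofracM ['X_[b] * _]mulrC.
Qed.

Hypothesis (b0 : forall j, j \in sigma -> b j = 0%N).
Hypothesis (bP : forall u, A u -> exists2 r, r \notin sigma & (b r < u r)%N).

(** If it were, then at [sigma] the Laurent polynomial [f = X^b / x_sigma^(k+1)]
    would be the sum of [g = s X^b / x_sigma^k], of [d], whose [j]-th term has
    no negative power of [X_j], and of an element of [I S_{x_sigma}], all of
    whose monomials exceed [b] somewhere outside [sigma].  In none of the three
    does the Laurent monomial [f] occur. *)
Lemma witness_not_coboundary k s : (0 < #|sigma|)%N ->
  ~ cech_coboundary I #|sigma| (x k.+1 - s *: x k).
Proof.
move=> sigma_gt0; have [j0 j0s] := card_gt0P sigma_gt0.
case E: #|sigma| sigma_gt0 => [//|t] _ [y cy /(_ sigma)].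
rewrite E eqxx scale_single !ffunE eqxx.
set f := mfrac _ _; set g := tofrac s * _; set d := \sum_(j in sigma) _ => loc.
pose V := @vanishing_coef K n b (ind_mnm sigma *+ k.+1).
have Vd : V d.
  rewrite /d; apply: (big_ind V) => [||j js].
  - exact: vanishing_coef0.
  - exact: vanishing_coefD.
  suff Vy : V (y (sigma :\ j)).
    rewrite -signr_odd mulr_sign; case: ifP => // _; exact: vanishing_coefN.
  have := cy (sigma :\ j); rewrite ifT; last first.
    by apply/eqP/succn_inj; rewrite -E (cardsD1 j sigma) js.
  move=> /localizedE[p [e [_ ->]]]; exists p, (ind_mnm (sigma :\ j) *+ e)%MM.
  split=> // w /mnmP/(_ j).
  rewrite !(mnmDE, mulmnE, mnmE) !inE eqxx js (b0 js) /=; lia.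
have Vg : V g.
  exists (s * 'X_[b]), (ind_mnm sigma *+ k)%MM; split.
    by rewrite /g /mfrac mulrA tofracM.
  move=> w /mnmP/(_ j0); rewrite mcoeffMX_if !(mnmDE, mulmnE, mnmE) j0s.
  by case: ifP => // /mnm_lepP/(_ j0); lia.
have Vl : V (f - g - d).
  move/localizedE: loc => [p [e [Ip ->]]]; exists p, (ind_mnm sigma *+ e)%MM.
  split=> // w wE; apply/eqP/negPn/negP => pw0.
  move/IA: Ip => /mcoeff_span/(_ pw0)[u Au /mnm_lepP uw].
  have [r rs] := bP Au; move: wE => /mnmP/(_ r); move: (uw r).
  by rewrite !(mnmDE, mulmnE, mnmE) (negPf rs); lia.
apply: (@nonvanishing_coef K n b (ind_mnm sigma *+ k.+1)).
rewrite -/f -[f](subrK g) -[f - g](subrK d).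
by apply: vanishing_coefD => //; apply: vanishing_coefD.
Qed.

Lemma local_cohomology_infinite_length : (0 < #|sigma|)%N ->
    (forall l, l \notin sigma ->
       exists2 u, A u & forall r, r \notin l |: sigma -> (u r <= b r)%N) ->
  ~ local_cohomology_finite_length I #|sigma|.
Proof.
move=> sigma_gt0 below.
apply: (@infinite_length_quotient _ _ _ _ x (xprod K sigma)).
- exact: cech_cocycle_submodule.
- exact: cech_coboundary_submodule.
- exact: cech_coboundary_cocycle.
- by move=> k; apply: witness_cocycle.
- exact: scale_witness.
- by move=> k s; apply: witness_not_coboundary.
Qed.

End Witness.

End Cech.

(** * The theorem *)

Theorem theorem2 (K : fieldType) (n m : nat) (I : {mpoly K[n]} -> Prop) (i : nat)
    (hI : monomial_ideal I) (hm : pure_powers_from I m) (hi : (0 < i)%N)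
    (hfin : local_cohomology_finite_length I i)
    (sigma : {set 'I_n}) (hsigma : is_face I sigma)
    (hdim : face_dim sigma = i%:Z - 1)
    (a : {ffun 'I_n -> int}) (hab : admissible I sigma a)
    (hc : maximal_admissible I sigma a) :
  exists l : 'I_n,
    [/\ (l < m)%N, l \notin sigma,
        a l = (rho I l)%:Z - 1 &
        forall u : 'X_{1..n}, u \in mingens0 I -> u l = rho I l ->
          Lset (subst_rho I a (l |: sigma)) u != set0].
Proof.
have ci : #|sigma| = i by move: hdim; rewrite /face_dim; lia.
have [a_ge0 a_le aL] := hab.
have a_ge0' j : 0 <= a j by have := a_ge0 j; rewrite ffunE.
have a_lt j : a j < (rho I j)%:Z by have := a_le j; rewrite ffunE; lia.
have [_ genI _] := mingensP hI.
have le_rho u j : u \in mingens I -> (u j <= rho I j)%N.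
  by move=> uG; apply: (@leq_bigmax_seq _ (mingens I) xpredT (fun u => u j)).
have pure_j j r : (U_(j) *+ rho I j)%MM r = if j == r then rho I j else 0%N.
  by rewrite mulmnE mnm1E; case: (j == r); rewrite ?mul1n ?mul0n.
have nonface u : u \in mingens I -> exists2 r, r \notin sigma & a r < (u r)%:Z.
  move=> uG; have := hsigma u uG; case: (hm.2 u).1 => // [[j mj uE]|u0 _].
    case/subsetPn => r; rewrite inE uE pure_j.
    case: (j =P r) => [<- _ js|_]; last by rewrite eqxx.
    by exists j => //; rewrite pure_j eqxx; apply: a_lt.
  have /set0Pn[r] := aL u u0; rewrite inE ffunE.
  case: ifPn => [_|rs]; last by exists r.
  by have := le_rho _ r uG; lia.
have [l ls lP] : exists2 l, l \notin sigma &
    forall u, u \in mingens I -> exists2 r, r \notin l |: sigma & a r < (u r)%:Z.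
  apply: NNPP => nl.
  pose b : 'X_{1..n} := [multinom (if j \in sigma then 0 else `|a j|)%N | j < n].
  have bE r : r \notin sigma -> (b r)%:Z = a r.
    by move=> /negPf rs; rewrite mnmE rs; have := a_ge0' r; lia.
  apply: (@local_cohomology_infinite_length K n I _ genI sigma b).
  - by move=> j js; rewrite mnmE js.
  - by move=> u /nonface[r rs ar]; exists r => //; have := bE r rs; lia.
  - by rewrite ci.
  - move=> l ls; apply: NNPP => nu; apply: nl; exists l => // u uG.
    apply: NNPP => nr; apply: nu; exists u => // r rls.
    rewrite leqNgt; apply/negP => br; apply: nr; exists r => //.
    by rewrite -bE ?ltz_nat //; apply: contra rls; rewrite inE orbC => ->.
  - by rewrite ci.
have lL u : u \in mingens0 I -> exists2 r, r \notin l |: sigma & a r < (u r)%:Z.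
  by rewrite mem_filter => /andP[_]; apply: lP.
exists l; split=> //.
- rewrite ltnNge; apply/negP => ml.
  have [|r rls] := lP (U_(l) *+ rho I l)%MM.
    by apply/hm.2; left; exists l.
  rewrite pure_j; case: eqP rls => [<-|_ _]; first by rewrite !inE eqxx.
  by rewrite ltNge a_ge0'.
- apply: NNPP => al.
  pose a' : {ffun 'I_n -> int} := [ffun j => if j == l then a l + 1 else a j].
  suff /ffunP/(_ l) : subst_rho I a' sigma = subst_rho I a sigma.
    by rewrite !ffunE (negPf ls) eqxx; lia.
  apply: hc.
  + split=> [j|j|u /lL[r]].
    * by rewrite !ffunE; case: eqP => _; have := a_ge0' j; have := a_ge0' l; lia.
    * rewrite !ffunE; case: eqP => [->|_]; last by have := a_lt j; lia.
      by have := a_lt l; lia.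
    * rewrite !inE negb_or => /andP[rl rs] ar; apply/set0Pn; exists r.
      by rewrite inE !ffunE (negPf rs) (negPf rl).
  + by move=> j; rewrite !ffunE; case: ifP => // _; case: eqP => [->|_] //; lia.
- move=> u /lL[r rls ar] _; apply/set0Pn; exists r.
  by rewrite inE ffunE (negPf rls).
Qed.
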